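(* Let $s$ be a Sturmian word having a prefixal factorization $s=U_1U_2\cdots$. Then there exist integers $i,j\ge 1$ such that $r_s(U_i)\ne r_s(U_j)$.
   Context: For a finite word $u$ and a letter $x$, $|u|$ is the length of $u$ and $|u|_x$ the number of occurrences of $x$ in $u$. An infinite word $s\in\{a,b\}^\omega$ is Sturmian if it is aperiodic (not of the form $vu^\omega$ with $v$ a finite, possibly empty, word and $u$ a non-empty finite word) and balanced, i.e. $\big||u|_x-|v|_x\big|\le1$ for every $x\in\{a,b\}$ and all factors $u,v$ of $s$ with $|u|=|v|$. A prefixal factorization of $s$ is an expression $s=U_1U_2\cdots$ in which every $U_i$ is a non-empty prefix of $s$. A non-empty factor $w$ of a Sturmian word $s$ is rich in the letter $z\in\{a,b\}$ if there is a factor $v$ of $s$ with $|v|=|w|$ and $|w|_z>|v|_z$. Each non-empty factor $w$ of a Sturmian word $s$ is rich in exactly one of the letters $a,b$; this letter is denoted $r_s(w)$. *)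

(* Defs.v *)
From mathcomp Require Import all_boot ssrint.
From mathcomp Require Import zify.
From mathcomp Require Import boolp classical_sets.

Set Implicit Arguments.
Unset Strict Implicit.
Unset Printing Implicit Defensive.

(* The alphabet {a, b}; every notion below is invariant under swapping the two
   letters, so which boolean stands for a is immaterial. *)
Notation letter := bool.
Notation word := (seq letter).
Notation infword := (nat -> letter).

Definition subword (s : infword) (i n : nat) : word :=
  mkseq (fun k => s (i + k)) n.

Definition is_prefix (u : word) (s : infword) : Prop :=
  u = subword s 0 (size u).

Definition is_factor (u : word) (s : infword) : Prop :=
  exists i, u = subword s i (size u).

(* u^omega; only meaningful when u is non-empty *)
Definition omega_power (u : word) : infword :=
  fun k => nth false u (k %% size u).

Definition app_inf (v : word) (t : infword) : infword :=
  fun k => if k < size v then nth false v k else t (k - size v).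

Definition aperiodic (s : infword) : Prop :=
  ~ exists v u : word, u <> [::] /\ s =1 app_inf v (omega_power u).

(* The distance `|m - n| below is taken in int, without truncation. *)
Definition balanced (s : infword) : Prop :=
  forall (x : letter) (u v : word), is_factor u s -> is_factor v s ->
    size u = size v -> (`|count_mem x u - count_mem x v| <= 1)%N.

Definition sturmian (s : infword) : Prop := aperiodic s /\ balanced s.

(* s = U 0 U 1 U 2 ...: every finite product of the first U i is a prefix of s.
   This determines s since the U i are non-empty. *)
Definition prefixal_factorization (s : infword) (U : nat -> word) : Prop :=
  (forall i, U i <> [::] /\ is_prefix (U i) s) /\
  (forall n, is_prefix (flatten (mkseq U n)) s).

Definition rich (s : infword) (w : word) (z : letter) : Prop :=
  exists v, [/\ is_factor v s, size v = size w & count_mem z v < count_mem z w].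

(* The letter in which w is rich; unique when s is Sturmian and w is a
   non-empty factor of s (rich_letter_unique), arbitrary if there is none. *)
Definition rich_letter (s : infword) (w : word) : letter :=
  xget false (rich s w).

Lemma count_letters (w : word) : count_mem true w + count_mem false w = size w.
Proof.
by elim: w => //= x w <-; case: x; rewrite /= ?add0n ?add1n ?addSn ?addnS.
Qed.

Lemma size_subword s i n : size (subword s i n) = n.
Proof. exact: size_mkseq. Qed.

Lemma factor_subword s i n : is_factor (subword s i n) s.
Proof. by exists i; rewrite size_subword. Qed.

Lemma subwordS s i n : subword s i n.+1 = s i :: subword s i.+1 n.
Proof.
rewrite /subword /mkseq /= addn0 -[1]/(1 + 0) iotaDl -map_comp; congr cons.
by apply: eq_map => k /=; rewrite add1n addSnnS.
Qed.

Lemma subwordSr s i n : subword s i n.+1 = rcons (subword s i n) (s (i + n)).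
Proof. by rewrite /subword mkseqS. Qed.

Lemma rich_letter_unique s w : sturmian s -> w <> [::] -> is_factor w s ->
  exists! z, rich s w z.
Proof.
move=> [aps bal] wn0 ws.
have [[z rz]|nr] := pselect (exists z, rich s w z); last first.
  case: aps; exists [::], (subword s 0 (size w)).
  have sw0 : 0 < size w by case: (w) wn0.
  split; first by case: (size w) sw0 => // n _; rewrite subwordS.
  have cnt i z : count_mem z w <= count_mem z (subword s i (size w)).
    rewrite leqNgt; apply/negP => lt; apply: nr; exists z.
    by exists (subword s i (size w)); split;
      [exact: factor_subword | rewrite size_subword |].
  have cntE i : count_mem true (subword s i (size w)) = count_mem true w.
    have := cnt i true; have := cnt i false.
    have := count_letters w; have := count_letters (subword s i (size w)).
    rewrite size_subword; lia.
  have per i : s (i + size w) = s i.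
    have := cntE i; rewrite -(cntE i.+1); case: (size w) sw0 => // n _.
    rewrite subwordS subwordSr -cats1 count_cat /= addSnnS addn0.
    by case: (s i); case: (s _) => //=; lia.
  have perm m i : s (i + m * size w) = s i.
    by elim: m => [|m IH]; rewrite ?addn0 // mulSnr addnA per.
  move=> k; rewrite /app_inf /= subn0 /omega_power size_subword.
  rewrite nth_mkseq ?ltn_mod // add0n.
  by rewrite {1}(divn_eq k (size w)) addnC perm.
exists z; split=> // z' [v' [fv' sv' cv']]; case: rz => v [fv sv cv].
have := bal true v v' fv fv' (etrans sv (esym sv')).
have := count_letters v; have := count_letters v'; have := count_letters w.
by move: z z' cv cv' => [] [] //=; lia.
Qed.

Lemma rich_letterP s w z : sturmian s -> w <> [::] -> is_factor w s ->
  rich_letter s w = z <-> rich s w z.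
Proof.
move=> ss wn0 ws; have [z0 [rz0 uz0]] := rich_letter_unique ss wn0 ws.
have -> : rich_letter s w = z0 by apply: xget_unique => // y /uz0.
by split=> [<-//|/uz0].
Qed.

(* Main.v *)
Require Import Defs.
From mathcomp Require Import all_boot.
From mathcomp Require Import zify boolp.

(** Suppose that every [U k] is rich in the same letter [z], and let [t k] be
    the tail of [s] starting with [U k].  Order tails by comparing the number
    of [z] in their prefixes of each length.  Removing a prefix with the
    maximal number of [z] for its length lowers a tail, so [t] is decreasing;
    by aperiodicity [t 1] has fewer [z] than [s] in some prefix of length [m],
    hence so has each [t k] with [k > 0].  Since [t k] and [s] share the prefix
    [U k], its length is less than [m], and some length [n] occurs for
    infinitely many [k].  Deleting only factors of length [n], starting from
    such a tail, gives tails that stay above some [t k], so all the deleted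
    factors are rich in [z]; these tails decrease, hence their prefixes of
    length [n] are eventually constant and [s] is ultimately periodic. *)

Definition occ (z : letter) (s : infword) (i n : nat) : nat :=
  count_mem z (subword s i n).

Definition occ_le (z : letter) (s : infword) (i j : nat) : Prop :=
  forall m, occ z s i m <= occ z s j m.

Definition occ_max (z : letter) (s : infword) (i n : nat) : Prop :=
  forall j, occ z s j n <= occ z s i n.

Lemma subwordD s i m n :
  subword s i (m + n) = subword s i m ++ subword s (i + m) n.
Proof.
elim: m i => [|m IH] i; first by rewrite addn0.
by rewrite addSn !subwordS IH addSnnS.
Qed.

Lemma occD z s i m n : occ z s i (m + n) = occ z s i m + occ z s (i + m) n.
Proof. by rewrite /occ subwordD count_cat. Qed.

Lemma occS z s i n : occ z s i n.+1 = occ z s i n + (s (i + n) == z).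
Proof. by rewrite /occ subwordSr -cats1 count_cat /= addn0. Qed.

(** The alphabet being binary, each increment of the count reveals the letter. *)
Lemma occ_inj z s i j n :
  (forall m, m <= n -> occ z s i m = occ z s j m) ->
  forall m, m < n -> s (i + m) = s (j + m).
Proof.
move=> e m mn; have := e m.+1 mn; rewrite !occS (e m (ltnW mn)).
by move/addnI; case: (s (i + m)); case: (s (j + m)); case: (z).
Qed.

Lemma occ_le_trans z s i j k :
  occ_le z s i j -> occ_le z s j k -> occ_le z s i k.
Proof. by move=> ij jk m; apply: leq_trans (ij m) (jk m). Qed.

(** Cut the window of length [n + m] at [i] after [n] letters and after [m] letters: its last [n]
    letters hold at most as many [z] as its first [n]. *)
Lemma occ_le_drop_max z s i n : occ_max z s i n -> occ_le z s (i + n) i.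
Proof.
move=> mx m; have := occD z s i m n; have := mx (i + m).
by rewrite [m + n]addnC occD; lia.
Qed.

(** The hypotheses force equal counts on the first [n] letters, and these cancel. *)
Lemma occ_le_drop_same z s i j n : occ_le z s i j -> occ_max z s i n ->
  occ_le z s (i + n) (j + n).
Proof.
move=> ij mx m; have := ij (n + m); have := mx j; have := ij n.
by rewrite !occD; lia.
Qed.

Lemma occ_max_le z s i j n :
  occ_le z s i j -> occ_max z s i n -> occ_max z s j n.
Proof. by move=> ij mx k; apply: leq_trans (mx k) (ij n). Qed.

Lemma rich_occ_max s z i n : balanced s -> rich s (subword s i n) z ->
  occ_max z s i n.
Proof.
move=> bal [v [fv]]; rewrite size_subword => sv cv j.
have := bal z _ v (factor_subword s j n) fv; rewrite size_subword sv.
by move/(_ erefl); rewrite /occ; lia.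
Qed.

Lemma aperiodic_shift s p n : aperiodic s -> 0 < n ->
  ~ (forall j r, r < n -> s (p + j * n + r) = s (p + r)).
Proof.
move=> aps n0 per; apply: aps; exists (subword s 0 p), (subword s p n).
split; first by move/(congr1 size); rewrite size_subword /=; lia.
move=> k; rewrite /app_inf /omega_power !size_subword.
case: ltnP => kp; first by rewrite nth_mkseq.
have r0 := ltn_pmod (k - p) n0.
rewrite nth_mkseq // -(per ((k - p) %/ n)) //.
by rewrite -addnA -divn_eq subnKC.
Qed.

Lemma nonincreasing_stationary (f : nat -> nat) :
  (forall j, f j.+1 <= f j) -> exists j0, forall j, f (j0 + j) = f j0.
Proof.
move=> dec; have ex : exists v, `[< exists j, f j = v >].
  by exists (f 0); apply/asboolP; exists 0.
case: (ex_minnP ex) => v /asboolP [j0 fj0] vmin; exists j0 => j.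
have := vmin (f (j0 + j)) (introT (asboolP _) (ex_intro _ _ erefl)).
have : f (j0 + j) <= f j0.
  elim: j => [|j IH]; first by rewrite addn0.
  by rewrite addnS; apply: leq_trans (dec _) IH.
lia.
Qed.

(** Induction on the bound: if [b] does not recur forever, it strictly bounds [f] from some point
    on. *)
Lemma bounded_recurrent_value (f : nat -> nat) b k0 :
  (forall k, k0 <= k -> f k < b) ->
  exists v, forall k, exists2 l, k <= l & f l = v.
Proof.
elim: b k0 => [|b IH] k0 fb; first by have := fb k0 (leqnn _).
have [|nb] := pselect (forall k, exists2 l, k <= l & f l = b).
  by exists b.
have [k nk] : exists k, ~ exists2 l, k <= l & f l = b.
  by apply: contra_notP nb => nk k; apply: contra_notP nk; exists k.
apply: (IH (maxn k0 k)) => l; rewrite geq_max => /andP[k0l kl].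
have := fb l k0l; rewrite ltnS leq_eqVlt => /orP[/eqP fl|//].
by case: nk; exists l.
Qed.

Lemma occ_max_blocks_periodic z s p n : aperiodic s -> 0 < n ->
  ~ (forall j, occ_max z s (p + j * n) n).
Proof.
move=> aps n0 mx.
pose x j := p + j * n.
have xS j : x j.+1 = x j + n by rewrite /x mulSnr addnA.
have dec j : occ_le z s (x j.+1) (x j).
  by rewrite xS; apply: occ_le_drop_max; apply: mx.
(* Each summand is nonincreasing in [j], so once the sum is constant all counts up to length [n]
   are. *)
pose f j := \sum_(r < n.+1) occ z s (x j) r.
have fdec j : f j.+1 <= f j by apply: leq_sum => r _; apply: dec.
have [j0 fc] := nonincreasing_stationary f fdec.
have decj j : occ_le z s (x (j0 + j)) (x j0).
  elim: j => [|j IH]; first by rewrite addn0 => m.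
  by rewrite addnS; apply: occ_le_trans (dec _) IH.
apply: (@aperiodic_shift s (x j0) n aps n0) => j.
have -> : x j0 + j * n = x (j0 + j) by rewrite /x mulnDl addnA.
apply: (@occ_inj z) => m mn.
have /leqif_sum : forall r : 'I_n.+1, true ->
    occ z s (x (j0 + j)) r <= occ z s (x j0) r
    ?= iff (occ z s (x (j0 + j)) r == occ z s (x j0) r).
  by move=> r _; split=> //; apply: decj.
case=> _; rewrite -/(f _) -/(f _) fc eqxx => /esym/forallP eqs.
by have /eqP := eqs (Ordinal (mn : m < n.+1)).
Qed.

Theorem theorem6p7 (s : nat -> letter) (U : nat -> seq letter) :
  sturmian s -> prefixal_factorization s U ->
  exists i j : nat, rich_letter s (U i) <> rich_letter s (U j).
Proof.
move=> ss [Up Uf]; have [aps bal] := ss.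
apply: contrapT => same; pose z := rich_letter s (U 0).
pose n k := size (U k); pose N k := size (flatten (mkseq U k)).
have n_gt0 k : 0 < n k by rewrite /n; case: (U k) (Up k).1.
have U0 k : U k = subword s 0 (n k) by exact: (Up k).2.
have NS k : N k.+1 = N k + n k.
  by rewrite /N mkseqS flatten_rcons size_cat.
have UN k : U k = subword s (N k) (n k).
  have := Uf k.+1; rewrite /is_prefix -/(N k.+1) NS subwordD.
  rewrite mkseqS flatten_rcons => /eqP; rewrite eqseq_cat ?size_subword //.
  by move=> /andP[_ /eqP].
have mx k : occ_max z s (N k) (n k).
  apply: rich_occ_max => //; rewrite -UN; apply/rich_letterP => //.
  - exact: (Up k).1.
  - by rewrite UN; apply: factor_subword.
  - by apply: contrapT => ne; apply: same; exists k, 0.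
have dec k l : k <= l -> occ_le z s (N l) (N k).
  move=> /subnKC <-; elim: (l - k) => [|d IH]; first by rewrite addn0 => m.
  by rewrite addnS NS; apply: occ_le_trans (occ_le_drop_max _ _ _ _ (mx _)) IH.
have [m lt_m] : exists m, occ z s (N 1) m < occ z s (N 0) m.
  (* Without such an [m], dropping [U 0] leaves [s] unchanged, so [s] has period [n 0]. *)
  apply: contrapT => nlt.
  have eqN i : occ z s (N 1) i = occ z s (N 0) i.
    apply/eqP; rewrite eqn_leq dec //= leqNgt; apply/negP => lt.
    by apply: nlt; exists i.
  have per r : s (n 0 + r) = s r.
    have := @occ_inj z s (N 1) (N 0) r.+1 (fun i _ => eqN i) r (ltnSn r).
    by rewrite NS /N.
  apply: (@aperiodic_shift s 0 (n 0) aps (n_gt0 0)) => j r _; rewrite !add0n.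
  by elim: j => [|j IH]; rewrite ?add0n // mulSn -addnA per.
have short k : 0 < k -> n k < m.
  move=> k0; rewrite ltnNge; apply/negP => mk.
  (* The word [U k] starts both [s] and the tail at [N k], and it would cover the first [m] letters
     of both. *)
  have : occ z s (N k) m = occ z s 0 m.
    rewrite /occ; have : subword s (N k) (n k) = subword s 0 (n k).
      by rewrite -UN U0.
    rewrite -(subnKC mk) !subwordD => /eqP.
    by rewrite eqseq_cat ?size_subword // => /andP[/eqP ->].
  have := dec 1 k k0 m; move: lt_m; rewrite {2}/N /=; lia.
have [v rec] := bounded_recurrent_value _ _ _ short.
have [k0 _ nk0] := rec 0.
apply: (@occ_max_blocks_periodic z s (N k0) v aps).
  by rewrite -nk0.
have above j : exists k, occ_le z s (N k) (N k0 + j * v).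
  elim: j => [|j [k le_k]]; first by exists k0; rewrite addn0 => i.
  (* As [U l] has length [v], deleting it and deleting the next [v] letters of the upper tail are
     equally long cuts. *)
  have [l kl nl] := rec k; exists l.+1.
  rewrite NS nl mulSnr addnA; apply: occ_le_drop_same; last by rewrite -nl.
  exact: occ_le_trans (dec _ _ kl) le_k.
move=> j; have [k le_k] := above j; have [l kl nl] := rec k.
apply: (@occ_max_le z s (N l)); last by rewrite -nl.
exact: occ_le_trans (dec _ _ kl) le_k.
Qed.
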